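(* Let $\mu\in[0,1)\cup i\mathbb{R}^+$. For each $n\ge0$ and $0\le m\le n+1$, the basic spheroidal monogenic polynomial $X_{n,m}^\pm[\mu]=\partial U_{n+1,m}^\pm[\mu]$ satisfies $$X_{n,m}^\pm[\mu]=V_{n,m}^\pm[\mu]+\frac{e_1}{2}\Big((n+m+1)V_{n,m-1}^\pm[\mu]-\frac{1}{n+m+2}V_{n,m+1}^\pm[\mu]\Big)\mp\frac{e_2}{2}\Big((n+m+1)V_{n,m-1}^\mp[\mu]+\frac1{n+m+2}V_{n,m+1}^\mp[\mu]\Big).$$ Moreover the $X_{n,m}^\pm[\mu]$ are polynomials in $\mu^2$ as well as in $x_0,x_1,x_2$.
   Context: Let $\phi$ be the angle with $x_1=\rho\cos\phi$, $x_2=\rho\sin\phi$, $\rho=\sqrt{x_1^2+x_2^2}$, and for integers $m$ let $\Phi_m^+(\phi)=\cos(m\phi)$, $\Phi_m^-(\phi)=\sin(m\phi)$. Legendre functions. $P_n^m$ ($m\ge0$) is the associated Legendre function: $P_n^m(t)=(-1)^m(1-t^2)^{m/2}\frac{d^mP_n}{dt^m}(t)$ for $t\in[-1,1]$ and $P_n^m(z)=\big((z^2-1)^{1/2}\big)^m\frac{d^mP_n}{dz^m}(z)$ for $z\in\mathbb{C}\setminus[-1,1]$, where $(z^2-1)^{1/2}$ is the branch asymptotic to $z$ at infinity. Spheroidal harmonics. For $\mu\ne0$ put $\omega=\sqrt{(x_0+\mu)^2+\rho^2}+\sqrt{(x_0-\mu)^2+\rho^2}$ (principal square roots; $\omega\geq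 0$) and $\widehat U_{n,m}[\mu](x)=\frac{(n-m)!}{(2n-1)!!}\,\mu^n P_n^m\!\left(\frac{2x_0}{\omega}\right)P_n^m\!\left(\frac{\omega}{2\mu}\right)$ for $0\le m\le n$ (with $(-1)!!=1$); for $\mu=0$ put $\widehat U_{n,m}[0](x)=|x|^nP_n^m(x_0/|x|)$. Put $\widehat U_{n,m}[\mu]=0$ for $m>n$. Let $U_{n,m}^\pm[\mu]=\widehat U_{n,m}[\mu]\,\Phi_m^\pm(\phi)$, extended by continuity to $\mathbb{R}^3$. (For $\mu\in(0,1)$, writing $x_0=\mu\cos u\cosh v$, $\rho=\mu\sin u\sinh v$, one has $2x_0/\omega=\cos u$, $\omega/(2\mu)=\cosh v$; the case $\mu\in i\mathbb{R}^+$ is the analytic continuation in $\mu$.) Let $\widehat V_{n,m}[\mu]=\frac{\partial}{\partial x_0}\widehat U_{n+1,m}[\mu]$ for $m\ge0$, and $V_{n,m}^\pm[\mu]=\frac{\partial}{\partial x_0}U_{n+1,m}^\pm[\mu]=\widehat V_{n,m}[\mu]\Phi_m^\pm$. Thus $V_{n,m}^\pm=0$ for $m\ge n+1$. For $m=-1$ (arising when $m=0$ in the claim) put $\widehat V_{n,-1}[\mu]=-\frac{1}{(n+1)(n+2)}\widehat V_{n,1}[\mu]$ and $V_{n,-1}^\pm[\mu]=\widehat V_{n,-1}[\mu]\,\Phi_{-1}^\pm$, with $\Phi_{-1}^+=\cos\phi$, $\Phi_{-1}^-=-\sin\phi$. $\mathbb{R}^3$ is identified with $\{x_0+x_1e_1+x_2e_2\}$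 inside the quaternions, and $\partial=\frac{\partial}{\partial x_0}-e_1\frac{\partial}{\partial x_1}-e_2\frac{\partial}{\partial x_2}$. *)

(* Defs.v *)
From HB Require Import structures.
From mathcomp Require Import all_boot all_order all_algebra.
From mathcomp Require Import all_classical all_reals all_analysis.
From mathcomp Require Import complex.
From mathcomp Require mpoly.

Set Implicit Arguments.
Unset Strict Implicit.
Unset Printing Implicit Defensive.

Import Order.TTheory GRing.Theory Num.Theory numFieldNormedType.Exports.
Local Open Scope classical_set_scope.
Local Open Scope ring_scope.
Local Open Scope complex_scope.

(* On R[i] the order is partial: [a <= z] forces [z - a] to be real, so that
   [0 <= mu < 1] says that mu is a real number of [0, 1), [0 < w] that w is a
   positive real number, and [-1 <= z <= 1] that z is in the real segment.
   [complex.sqrtc] is the principal square root, with cut (-oo, 0]. *)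

Section Spheroidal.
Variable R : realType.
Implicit Types (mu z : R[i]) (x : 'rV[R]_3) (n m : nat) (s : bool).

Definition spheroidal_param mu : Prop :=
  0 <= mu < 1 \/ exists2 a : R, 0 < a & mu = a *i.

Definition odd_fact n : nat := (\prod_(i < n) i.*2.+1)%N. (* (2n-1)!! *)

(* Rodrigues' formula *)
Definition legendre n : {poly R[i]} :=
  ((2 ^ n * n`!)%:R)^-1 *: (('X ^+ 2 - 1) ^+ n)^`(n).

(* For z outside [-1, 1], 1 - z^-2 avoids (-oo, 0], so [z * sqrtc (1 - z^-2)]
   is the branch of (z^2 - 1)^(1/2) that is asymptotic to z at infinity. *)
Definition assoc_legendre n m z : R[i] :=
  (if -1 <= z <= 1 then (-1) ^+ m * sqrtc (1 - z ^+ 2) ^+ m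
   else (z * sqrtc (1 - z ^- 2)) ^+ m) * ((legendre n)^`(m)).[z].

Definition rho x : R := Num.sqrt (x 0 1 ^+ 2 + x 0 2 ^+ 2).

Definition euclid_norm x : R :=
  Num.sqrt (x 0 0 ^+ 2 + x 0 1 ^+ 2 + x 0 2 ^+ 2).

(* Some determination of the angle; arbitrary on the axis rho = 0. *)
Definition phi x : R :=
  get [set t : R | x 0 1 = rho x * cos t /\ x 0 2 = rho x * sin t].

(* The superscripts + and - are encoded by [true] and [false]. *)
Definition Phi s (k : int) (t : R) : R :=
  if s then cos (k%:~R * t) else sin (k%:~R * t).

Definition omega mu x : R[i] :=
  sqrtc (((x 0 0)%:C + mu) ^+ 2 + (rho x)%:C ^+ 2) +
  sqrtc (((x 0 0)%:C - mu) ^+ 2 + (rho x)%:C ^+ 2).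

Definition Uhat_formula mu n m x : R[i] :=
  if (n < m)%N then 0
  else if mu == 0 then
    (euclid_norm x)%:C ^+ n * assoc_legendre n m (x 0 0 / euclid_norm x)%:C
  else
    ((n - m)`!%:R / (odd_fact n)%:R) * mu ^+ n *
    assoc_legendre n m (2 * (x 0 0)%:C / omega mu x) *
    assoc_legendre n m (omega mu x / (2 * mu)).

(* The formulas are unambiguous off the axis and where omega is a positive
   real.  The second condition only matters for mu = a *i: it excludes the
   disc x_0 = 0, rho <= a, on which both radicands lie on the cut of the
   principal square root. *)
Definition regular_points mu : set 'rV[R]_3 :=
  [set x | 0 < rho x /\ 0 < omega mu x].

(* Continuous extension to R^3 from the (dense, open) set of regular points:
   the real number to which the complex values f y converge as y tends to x
   through regular points. *)
Definition extend mu (f : 'rV[R]_3 -> R[i]) x : R :=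
  get [set r : R |
    (f y : R[i]^o) @[y --> within (regular_points mu) (nbhs x)]
      --> (r%:C : R[i]^o)].

Definition Uhat mu n m : 'rV[R]_3 -> R := extend mu (Uhat_formula mu n m).

Definition U mu n m s : 'rV[R]_3 -> R :=
  extend mu (fun x => Uhat_formula mu n m x * (Phi s m (phi x))%:C).

(* The only negative index that matters is m = -1. *)
Definition Vhat mu n (k : int) x : R :=
  match k with
  | Posz m => 'D_('e_0) (Uhat mu n.+1 m) x
  | Negz _ => - ((n.+1 * n.+2)%:R)^-1 * 'D_('e_0) (Uhat mu n.+1 1) x
  end.

Definition V mu n (k : int) s x : R :=
  match k with
  | Posz m => 'D_('e_0) (U mu n.+1 m s) x
  | Negz _ => Vhat mu n k x * Phi s k (phi x)
  end.

(* Quaternions, in the basis 1, e1, e2, e3 = e1 e2. *)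
Definition quat (a b c d : R) : 'rV[R]_4 := \row_(i < 4) [:: a; b; c; d]`_i.

Definition qmul (p q : 'rV[R]_4) : 'rV[R]_4 :=
  quat (p 0 0 * q 0 0 - p 0 1 * q 0 1 - p 0 2 * q 0 2 - p 0 3 * q 0 3)
       (p 0 0 * q 0 1 + p 0 1 * q 0 0 + p 0 2 * q 0 3 - p 0 3 * q 0 2)
       (p 0 0 * q 0 2 - p 0 1 * q 0 3 + p 0 2 * q 0 0 + p 0 3 * q 0 1)
       (p 0 0 * q 0 3 + p 0 1 * q 0 2 - p 0 2 * q 0 1 + p 0 3 * q 0 0).

Definition qreal (a : R) : 'rV[R]_4 := quat a 0 0 0.
Definition e1 : 'rV[R]_4 := quat 0 1 0 0.
Definition e2 : 'rV[R]_4 := quat 0 0 1 0.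

Definition del (f : 'rV[R]_3 -> 'rV[R]_4) x : 'rV[R]_4 :=
  'D_('e_0) f x - qmul e1 ('D_('e_1) f x) - qmul e2 ('D_('e_2) f x).

Definition X mu n m s : 'rV[R]_3 -> 'rV[R]_4 :=
  del (fun x => qreal (U mu n.+1 m s x)).

(* The point (mu^2, x_0, x_1, x_2); mu^2 is real for the admissible mu. *)
Definition poly_point mu x : 'I_4 -> R :=
  fun i => [:: complex.Re (mu ^+ 2); x 0 0; x 0 1; x 0 2]`_i.

End Spheroidal.

Arguments e1 {R}.
Arguments e2 {R}.

(* Main.v *)
Require Import Defs.
From mathcomp Require Import all_boot all_order all_algebra.
From mathcomp Require Import all_classical all_reals all_analysis.
From mathcomp Require Import complex ring lra zify.
From mathcomp Require mpoly.

(* The heart of the matter is the addition theorem for Legendre functions: off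
   the axis, the product P_N^m(2 x_0 / omega) P_N^m(omega / (2 mu)) equals, up to
   an explicit constant and a power of mu,
     rho^m * sum_k (-1)^k / (4^k k! (m + k)!) * rho^(2k) * L^(m + 2k)(x_0),
   where L(w) = mu^N P_N(w / mu) is a polynomial in mu^2 and w.  (This is
   Whittaker's representation: the sum is the m-th Fourier coefficient in theta
   of L(x_0 + i x_1 cos theta + i x_2 sin theta).)  As a function of
   t = 2 x_0 / omega, the sum satisfies the differential equation of P_N^(m),
   whose polynomial solutions are determined by their value at the regular
   singular point t = 1.  Hence U_{N,m} is a polynomial in mu^2, x_0, x_1, x_2,
   on which each of d/dx_1 and d/dx_2 acts by shifting the summation index,
   which gives the ladder relations with their factors N + m and
   1 / (N + m + 1). *)

(* The notations of mpoly clash with those of MathComp-Analysis. *)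
Import -(notations) mpoly.
Import Order.TTheory GRing.Theory Num.Theory numFieldNormedType.Exports.

Set Implicit Arguments.
Unset Strict Implicit.
Unset Printing Implicit Defensive.

Local Open Scope ring_scope.

(** * Homogenised Legendre polynomials *)

Section Rodrigues.
Variable A : comNzRingType.

(** The J-th derivative of (w^2 - b)^N in w, written out so that [b] and [w] may lie in any
    commutative ring, in particular be variables of [mpoly]. Where [2 * (N - i) - J] truncates, the
    falling factorial is 0. *)
Definition rodrigues (N J : nat) (b w : A) : A :=
  \sum_(i < N.+1)
    ((- b) ^+ i * w ^+ (2 * (N - i) - J)) *+ ('C(N, i) * (2 * (N - i)) ^_ J).

Lemma rodriguesE N J b w :
  ((('X^2 - b%:P) ^+ N)^`(J)).[w] = rodrigues N J b w.
Proof.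
rewrite exprDn (linear_sum (derivn J)) horner_sum; apply: eq_bigr => i _ /=.
rewrite derivnMn hornerMn -exprM -polyCN -polyC_exp mulrC mul_polyC derivnZ.
by rewrite derivnXn hornerZ hornerMn hornerXn mulrnAr -mulrnA
  [(_ ^_ _ * _)%N]mulnC [(2 * _)%N]mulnC.
Qed.

Lemma rodrigues_small N J b w : (2 * N < J)%N -> rodrigues N J b w = 0.
Proof.
move=> NJ; apply: big1 => i _.
by rewrite ffact_small ?muln0 ?mulr0n//; lia.
Qed.

(** Homogeneity: with weight 1 for [w] and 2 for [b], every nonzero term has weight 2N - J. *)
Lemma rodrigues_scale N J c b w : (J <= 2 * N)%N ->
  rodrigues N J (c ^+ 2 * b) (c * w) = c ^+ (2 * N - J) * rodrigues N J b w.
Proof.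
move=> JN; rewrite /rodrigues mulr_sumr; apply: eq_bigr => i _.
have [lt|le] := ltnP (2 * (N - i)) J.
  by rewrite (ffact_small lt) muln0 !mulr0n mulr0.
rewrite mulrnAr; congr (_ *+ _).
have -> : (2 * N - J = 2 * i + (2 * (N - i) - J))%N by have := ltn_ord i; lia.
by rewrite -mulrN [(_ * - b) ^+ _]exprMn [(_ * w) ^+ _]exprMn exprD exprM mulrACA.
Qed.

Lemma rodrigues0 N J w : rodrigues N J 0 w = w ^+ (2 * N - J) *+ (2 * N) ^_ J.
Proof.
rewrite /rodrigues big_ord_recl /= big1 ?addr0.
  by rewrite expr0 mul1r subn0 bin0 mul1n.
by move=> i _; rewrite oppr0 expr0n /= mul0r mul0rn.
Qed.

End Rodrigues.

Lemma rmorph_rodrigues (A B : comNzRingType) (f : {rmorphism A -> B}) N J b w :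
  f (rodrigues N J b w) = rodrigues N J (f b) (f w).
Proof.
rewrite rmorph_sum; apply: eq_bigr => i _.
by rewrite rmorphMn rmorphM !rmorphXn rmorphN.
Qed.

(** * Gegenbauer's differential equation and Legendre polynomials *)

Section Gegenbauer.
Variable K : numFieldType.
Implicit Types (a b c : K) (f g : {poly K}) (N m k : nat).

Definition gegenbauer_op b a c f : {poly K} :=
  ('X^2 - b%:P) * f^`()^`() + a *: ('X * f^`()) + c *: f.

Lemma deriv_gegenbauer b a c f :
  (gegenbauer_op b a c f)^`() = gegenbauer_op b (a + 2) (a + c) f^`().
Proof.
rewrite /gegenbauer_op !(derivD, derivN, derivM, derivC, derivX, derivXn, derivZ)
  /= -!mul_polyC; ring.
Qed.

(** Each derivative adds 2 to [a] and the current [a] to [c]; moreover a + (a + 2) + ... + (a + 2(j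
    - 1)) = j a + j(j - 1). *)
Lemma derivn_gegenbauer b a c f j : gegenbauer_op b a c f = 0 ->
  gegenbauer_op b (a + j.*2%:R) (c + a *+ j + (j * j.-1)%:R) f^`(j) = 0.
Proof.
move=> f0; elim: j => [|j IHj].
  by rewrite derivn0 mulr0n /= !addr0.
rewrite derivnS -[RHS](deriv0 K) -IHj deriv_gegenbauer; congr (gegenbauer_op _ _ _ _).
  by rewrite -!mul2n; ring.
by rewrite -!mul2n; case: j {IHj} => [|j] /=; ring.
Qed.

Lemma gegenbauer_at1 a c f : gegenbauer_op 1 a c f = 0 ->
  a * f^`().[1] = - c * f.[1].
Proof.
move=> /(congr1 (fun g => g.[1])); rewrite /gegenbauer_op !hornerE => h.
apply/eqP; rewrite mulNr -subr_eq0 opprK; apply/eqP; rewrite -[RHS]h.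
by rewrite expr1n subrr /= mulr1 mul0r add0r.
Qed.

(* Since 1 is a regular singular point of the equation, the equation determines
   all the derivatives of f at 1 from f.[1]. *)
Lemma gegenbauer_unique m c f : gegenbauer_op 1 m.+1.*2%:R c f = 0 ->
  f.[1] = 0 -> f = 0.
Proof.
move=> fE f1; have fj j : f^`(j).[1] = 0.
  elim: j => [|j IHj]; first by rewrite derivn0.
  have /gegenbauer_at1 := derivn_gegenbauer j fE.
  rewrite IHj mulr0 -derivnS => /eqP; rewrite mulf_eq0 -natrD pnatr_eq0.
  by rewrite addn_eq0 double_eq0 /= => /eqP.
apply/eqP/negPn/negP => fN0.
(* The derivative whose order is the degree of [f] is the leading coefficient times a factorial, a
   nonzero constant. *)
have := fj (size f).-1; have sf := polySpred fN0.
have : (size f^`((size f).-1) <= 1)%N.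
  apply/leq_sizeP => i i1.
  by rewrite coef_derivn nth_default ?mul0rn// {1}sf -addn1 leq_add2l.
move=> /size1_polyC ->; rewrite hornerC coef_derivn addn0 -lead_coefE ffactnn.
by move=> /eqP; rewrite mulrn_eq0 lead_coef_eq0 (negPf fN0) orbF eqn0Ngt fact_gt0.
Qed.

Lemma derivn_derivn f j k : (f^`(j))^`(k) = f^`(k + j).
Proof. by rewrite /derivn iterD. Qed.

(** With [b] = mu^2 this is the L of the overview, mu^N P_N(w / mu). It is P_N at [b = 1] and a
    multiple of w^N at [b = 0]. *)
Definition hlegendre N b : {poly K} :=
  ((2 ^ N * N`!)%:R)^-1 *: (('X^2 - b%:P) ^+ N)^`(N).

Lemma hlegendreE N b m w :
  (hlegendre N b)^`(m).[w] = ((2 ^ N * N`!)%:R)^-1 * rodrigues N (N + m) b w.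
Proof.
by rewrite derivnZ hornerZ derivn_derivn addnC rodriguesE.
Qed.

(** The power u = (X^2 - b)^N satisfies (X^2 - b) u' = 2 N X u. Differentiating once gives
    Gegenbauer form, and N + m further derivatives give these parameters. *)
Lemma hlegendre_ode N b m :
  gegenbauer_op b m.+1.*2%:R ((m * m.+1)%:R - (N * N.+1)%:R)
    (hlegendre N b)^`(m) = 0.
Proof.
set u := ('X^2 - b%:P) ^+ N.
have u1 : ('X^2 - b%:P) * u^`() = (N.*2)%:R *: ('X * u).
  rewrite deriv_exp derivB derivC derivXn subr0 /=.
  case: (N) @u => [|n] u; first by rewrite /= mulr0n mulr0 scale0r.
  by rewrite /u /=; set p := _ - b%:P; rewrite [p ^+ n.+1]exprS -mul_polyC -mul2n; ring.
have uE : gegenbauer_op b (2 - (N.*2)%:R) (- (N.*2)%:R) u = 0.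
  rewrite -[RHS](deriv0 K) -(subrr (('X^2 - b%:P) * u^`())) {2}u1.
  rewrite /gegenbauer_op !(derivD, derivN, derivM, derivC, derivX, derivZ).
  by rewrite -!mul_polyC; ring.
have := derivn_gegenbauer (N + m) uE.
rewrite /hlegendre derivnZ derivn_derivn (addnC m); set v := u^`(_).
rewrite /gegenbauer_op !derivZ -!mul_polyC => h.
transitivity (((2 ^ N * N`!)%:R)^-1%:P * (0 : {poly K})); last by rewrite mulr0.
have e1 : 2 - (N.*2)%:R + ((N + m).*2)%:R = m.+1.*2%:R :> K.
  by rewrite -!mul2n !(natrM, natrD, mulrSr); ring.
have e2 : - (N.*2)%:R + (2 - (N.*2)%:R) *+ (N + m) + ((N + m) * (N + m).-1)%:R
   = (m * m.+1)%:R - (N * N.+1)%:R :> K.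
  case e: (N + m)%N => [|j].
    have [-> ->] : N = 0%N /\ m = 0%N by lia.
    by rewrite mulr0n; ring.
  have jE : j%:R = N%:R + m%:R - 1 :> K by rewrite -natrD e mulrSr; ring.
  by rewrite -[_ *+ j.+1]mulr_natl /= -!mul2n !(natrM, natrD, mulrSr) jE; ring.
rewrite -h e1 e2; ring.
Qed.

(** By Leibniz' rule only the term in which all N derivatives fall on (X - 1)^N survives at 1. *)
Lemma horner1_rodrigues f N : ((('X - 1) ^+ N * f)^`(N)).[1] = N`!%:R * f.[1].
Proof.
elim: N f => [|N IHN] f; first by rewrite mul1r derivn0 mul1r.
rewrite derivSn derivM deriv_exp derivB derivX derivC subr0 mul1r /=.
have -> : ('X - 1) ^+ N *+ N.+1 * f + ('X - 1) ^+ N.+1 * f^`()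
  = ('X - 1) ^+ N * (N.+1%:R *: f + ('X - 1) * f^`()).
  by rewrite exprS -mul_polyC -mulr_natl polyC_natr; ring.
by rewrite IHN !hornerE subrr mul0r addr0 factS natrM; ring.
Qed.

(** P_N(1) = 1 comes from Rodrigues' formula and X^2 - 1 = (X - 1)(X + 1). Then the equation at 1
    reads 2(m + 1) P^(m+1)(1) = (N - m)(N + m + 1) P^(m)(1). *)
Lemma hlegendre_at1 N m : (m <= N)%N ->
  (hlegendre N 1)^`(m).[1] = (N + m)`!%:R / (2 ^ m * m`! * (N - m)`!)%:R.
Proof.
elim: m => [_|m IHm mN].
  rewrite derivn0 hornerZ.
  have -> : 'X^2 - 1%:P = ('X - 1) * ('X + 1) :> {poly K} by ring.
  rewrite exprMn horner1_rodrigues.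
  have -> : (('X + 1) ^+ N : {poly K}).[1] = (2 ^ N)%:R.
    by rewrite horner_exp !hornerE natrX.
  have nz k : (0 < k)%N -> k%:R != 0 :> K by rewrite pnatr_eq0 -lt0n.
  rewrite addn0 subn0 expn0 fact0 !mul1n -natrM mulnC.
  by rewrite mulVf ?mulfV// nz ?muln_gt0 ?expn_gt0 ?fact_gt0.
have /gegenbauer_at1 := hlegendre_ode N 1 m.
rewrite -derivnS IHm 1?ltnW// => h.
have a0 : m.+1.*2%:R != 0 :> K by rewrite pnatr_eq0.
apply: (mulfI a0); rewrite h.
have -> : (N - m = (N - m.+1).+1)%N by lia.
rewrite addnS !factS expnS -mul2n !natrM.
have NE : N%:R = (N - m.+1)%:R + m%:R + 1 :> K.
  by rewrite -{1}(subnK mN) natrD mulrSr; ring.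
have f1 : m`!%:R != 0 :> K by rewrite pnatr_eq0 -lt0n fact_gt0.
have f2 : (N - m.+1)`!%:R != 0 :> K by rewrite pnatr_eq0 -lt0n fact_gt0.
have p0 : (2 ^ m)%:R != 0 :> K by rewrite pnatr_eq0 -lt0n expn_gt0.
have g1 : m.+1%:R != 0 :> K by rewrite pnatr_eq0.
have g2 : (N - m.+1).+1%:R != 0 :> K by rewrite pnatr_eq0.
move: g1 g2; rewrite !(mulrSr, natrD, NE) => g1 g2; field.
by rewrite f1 f2 p0 g1 g2.
Qed.

End Gegenbauer.

(** * The addition theorem *)

Section Addition.
Variable K : numFieldType.
Implicit Types (b c t w z : K) (f g : {poly K}) (N m k : nat).

Lemma comp_gegenbauer b z a c f : gegenbauer_op b a c f = 0 ->
  ((z *: 'X) ^+ 2 - b%:P) * (f^`()^`() \Po (z *: 'X))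
  + a%:P * ((z *: 'X) * (f^`() \Po (z *: 'X))) + c%:P * (f \Po (z *: 'X)) = 0.
Proof.
move=> /(congr1 (fun g => g \Po (z *: 'X))).
rewrite /gegenbauer_op -!mul_polyC expr2.
rewrite !(comp_polyD, comp_polyM, comp_polyB, comp_polyC, comp_polyX).
by rewrite -expr2 -polyCN comp_polyC polyCN.
Qed.

(** The equation of [f] at zX, multiplied by (1 - X^2)^k, is subtracted. There remain a term with
    two more derivatives of [f] and one with a lower power of 1 - X^2, which telescope in the sum
    over k. *)
Lemma gegenbauer_term b z d m k f :
  gegenbauer_op b (m + k.*2).+1.*2%:R
    (((m + k.*2) * (m + k.*2).+1)%:R - d) f = 0 ->
  gegenbauer_op 1 m.+1.*2%:R ((m * m.+1)%:R - d)
    ((1 - 'X^2) ^+ k * (f \Po (z *: 'X))) =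
  (b - z ^+ 2)%:P * ((1 - 'X^2) ^+ k * (f^`()^`() \Po (z *: 'X)))
  - (4 * k * (m + k))%:R%:P * ((1 - 'X^2) ^+ k.-1 * (f \Po (z *: 'X))).
Proof.
move=> /(comp_gegenbauer z) fE.
rewrite -[LHS]subr0 -(mulr0 ((1 - 'X^2) ^+ k)) -fE {fE}.
rewrite /gegenbauer_op -!mul_polyC -!mul2n.
have dcomp g : (g \Po (z%:P * 'X))^`() = z%:P * (g^`() \Po (z%:P * 'X)).
  by rewrite deriv_comp derivM derivC derivX mul0r add0r mulr1 mulrC.
have sE : (1 - 'X^2 : {poly K})^`() = - (2%:R * 'X).
  by rewrite derivB derivC derivXn sub0r /= expr1 mulr_natl.
have d2X : (- (2%:R * 'X) : {poly K})^`() = - 2%:R.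
  by rewrite derivN mulr_natl derivMn derivX.
(* The cases 0 and 1 are separate because the exponents k - 1 and k - 2 would truncate there. *)
case: k => [|[|k]] /=.
- by rewrite expr0 !mul1r !(dcomp, derivM, derivC); ring.
- by rewrite expr1 expr0 !(dcomp, sE, d2X, derivM, derivD, derivC); ring.
- set s := 1 - 'X^2.
  have e1 : (s ^+ k.+2)^`() = - (2%:R * 'X) * s ^+ k.+1 * k.+2%:R.
    by rewrite deriv_exp sE mulr_natr.
  have e2 : (s ^+ k.+1)^`() = - (2%:R * 'X) * s ^+ k * k.+1%:R.
    by rewrite deriv_exp sE mulr_natr.
  have e3 : (k.+2%:R : {poly K})^`() = 0 by rewrite -polyC_natr derivC.
  rewrite !(dcomp, e1, e2, e3, d2X, derivM, derivD, derivC).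
  by rewrite (exprS _ k.+1) (exprS _ k) /s; ring.
Qed.

Definition gcoef m k : K := ((4 ^ k * k`! * (m + k)`!)%:R)^-1.

Lemma gcoefS m k : (4 * k.+1 * (m + k.+1))%:R * gcoef m k.+1 = gcoef m k.
Proof.
rewrite /gcoef addnS expnS !factS.
have -> : (4 * 4 ^ k * (k.+1 * k`!) * ((m + k).+1 * (m + k)`!)
  = (4 * k.+1 * (m + k).+1) * (4 ^ k * k`! * (m + k)`!))%N by ring.
by rewrite [in X in _ * X]natrM invfM mulVKf// pnatr_eq0.
Qed.

Lemma gegenbauer_opD b a c f g :
  gegenbauer_op b a c (f + g) = gegenbauer_op b a c f + gegenbauer_op b a c g.
Proof. by rewrite /gegenbauer_op !derivD -!mul_polyC; ring. Qed.

Lemma gegenbauer_opZ b a c d f :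
  gegenbauer_op b a c (d *: f) = d *: gegenbauer_op b a c f.
Proof. by rewrite /gegenbauer_op !derivZ -!mul_polyC; ring. Qed.

Lemma gegenbauer_op_sum b a c n (F : 'I_n -> {poly K}) :
  gegenbauer_op b a c (\sum_(i < n) F i) = \sum_(i < n) gegenbauer_op b a c (F i).
Proof.
apply: (big_morph _ (gegenbauer_opD b a c)).
by rewrite /gegenbauer_op !deriv0 !mulr0 !scaler0 !addr0.
Qed.

Lemma hlegendre_small N b j : (N < j)%N -> (hlegendre N b)^`(j) = 0.
Proof.
move=> Nj; apply/eqP/negPn/negP => n0.
suff: (size ((hlegendre N b)^`(j)) <= 0)%N by rewrite leqn0 size_poly_eq0 (negPf n0).
apply/leq_sizeP => i _; rewrite coef_derivn.
rewrite nth_default ?mul0rn//; apply: leq_trans (_ : N.+1 <= _)%N; last by lia.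
apply: leq_trans (size_scale_leq _ _) _; apply/leq_sizeP => k Nk.
rewrite coef_derivn nth_default ?mul0rn//.
apply: leq_trans (size_exp_leq _ _) _; rewrite size_XnsubC//=; lia.
Qed.

(** The sum of the overview, with the sign (-1)^k absorbed into r = - rho^2. Any length n > N gives
    the full series, as derivatives of order above N vanish. *)
Definition addition_sum N m n b w r : K :=
  \sum_(k < n) gcoef m k * r ^+ k * (hlegendre N b)^`(m + k.*2).[w].

(** To be used with z = omega / 2, t = 2 x_0 / omega, [w] = x_0 and [r] = - rho^2. For fixed z, both
    sides are solutions in t of one equation, and they agree at t = 1. *)
Lemma addition_formula N m n b z t w r : (N < n)%N -> w = z * t ->
  r = (b - z ^+ 2) * (1 - t ^+ 2) ->
  addition_sum N m n b w r * (m`!%:R * (hlegendre N 1)^`(m).[1]) =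
  (hlegendre N b)^`(m).[z] * (hlegendre N 1)^`(m).[t].
Proof.
move=> Nn -> ->; set L := hlegendre N b; set P := hlegendre N 1.
pose T k := (1 - 'X^2) ^+ k * (L^`(m + k.*2) \Po (z *: 'X)).
pose G := \sum_(k < n) (gcoef m k * (b - z ^+ 2) ^+ k) *: T k.
have TE k s : (T k).[s] = (1 - s ^+ 2) ^+ k * L^`(m + k.*2).[z * s].
  by rewrite hornerM horner_exp horner_comp !hornerE.
have Gt s : G.[s] = addition_sum N m n b (z * s) ((b - z ^+ 2) * (1 - s ^+ 2)).
  rewrite horner_sum; apply: eq_bigr => k _.
  by rewrite hornerZ TE exprMn; ring.
(* At t = 1 the factor (1 - t^2)^k leaves only the term k = 0. *)
have G1 : m`!%:R * G.[1] = L^`(m).[z].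
  case: n @G Nn Gt => // n G _ _.
  rewrite horner_sum big_ord_recl big1 ?addr0 => [|i _].
    rewrite hornerZ TE !expr0 !mul1r !mulr1 addn0.
    by rewrite /gcoef expn0 !mul1n addn0 mulrA mulfV ?mul1r// pnatr_eq0 -lt0n fact_gt0.
  by rewrite hornerZ TE expr1n subrr expr0n mul0r mulr0.
set c : K := (m * m.+1)%:R - (N * N.+1)%:R.
have G0 : gegenbauer_op 1 m.+1.*2%:R c G = 0.
  (* The image of each term of the sum is a difference, and the sum telescopes. *)
  pose S k := if k is j.+1 then (gcoef m j * (b - z ^+ 2) ^+ k) *:
    ((1 - 'X^2) ^+ j * (L^`(m + k.*2) \Po (z *: 'X))) else 0.
  rewrite gegenbauer_op_sum.
  transitivity (\sum_(0 <= k < n) (S k.+1 - S k)).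
    rewrite big_mkord; apply: eq_bigr => k _; rewrite gegenbauer_opZ.
    rewrite (gegenbauer_term (b := b)); last exact: hlegendre_ode.
    rewrite -!derivnS scalerBr; congr (_ - _).
      by rewrite /S doubleS !addnS -!mul_polyC [_ ^+ k.+1]exprS; ring.
    case: (nat_of_ord k) => [|j]; first by rewrite muln0 mul0n polyC0 mul0r scaler0.
    by rewrite /S -(gcoefS m j) -!mul_polyC /=; ring.
  (* The boundary term contains a derivative of order m + 2n, which exceeds N. *)
  rewrite telescope_sumr// subr0 /S; case: (n) Nn => // j Nj.
  by rewrite hlegendre_small ?comp_poly0 ?mulr0 ?scaler0//; lia.
(* This combination solves the equation and vanishes at 1, so it is 0: proportionality of G and
   P^(m) without division. *)
pose H := P^`(m).[1] *: G + (- G.[1]) *: P^`(m).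
have H0 : H = 0.
  apply: (@gegenbauer_unique _ m c).
    rewrite gegenbauer_opD !gegenbauer_opZ G0 hlegendre_ode.
    by rewrite !scaler0 addr0.
  by rewrite hornerD !hornerZ; ring.
rewrite -Gt -G1; move/(congr1 (fun p : {poly K} => p.[t])): H0.
rewrite hornerD !hornerZ horner0 => /eqP; rewrite addr_eq0 => /eqP e.
by rewrite mulrCA [G.[t] * _]mulrC e; ring.
Qed.

End Addition.

(** * Ladder relations *)

(** The ladder relations only use these rules and the values of three derivations on [b], [w], [x],
    [y]. They are proved in an abstract algebra and later applied to [mderiv]. *)
Record derivation (K : pzRingType) (A : comAlgType K) (d : A -> A) : Prop := {
  derivationD : forall p q, d (p + q) = d p + d q;
  derivationM : forall p q, d (p * q) = d p * q + p * d q;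
  derivationZ : forall c p, d (c *: p) = c *: d p }.

Section Derivation.
Variables (K : pzRingType) (A : comAlgType K) (d : A -> A).
Hypothesis hd : derivation d.
Let dD := derivationD hd.
Let dM := derivationM hd.
Let dZ := derivationZ hd.

Lemma derivation0 : d 0 = 0.
Proof. by have := dZ 0 0; rewrite !scale0r. Qed.

Lemma derivationN p : d (- p) = - d p.
Proof. by rewrite -scaleN1r dZ scaleN1r. Qed.

Lemma derivationMn p n : d (p *+ n) = d p *+ n.
Proof. by rewrite -scaler_nat dZ scaler_nat. Qed.

Lemma derivation_sum n (F : 'I_n -> A) : d (\sum_(i < n) F i) = \sum_(i < n) d (F i).
Proof. exact: (big_morph _ dD derivation0). Qed.

Lemma derivation1 : d 1 = 0.
Proof. by apply: (addrI (d 1)); rewrite addr0 -{3}(mulr1 1) dM mulr1 mul1r. Qed.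

Lemma derivationX n p : d (p ^+ n) = n%:R * p ^+ n.-1 * d p.
Proof.
elim: n => [|n IHn]; first by rewrite derivation1 !mul0r.
rewrite exprS dM IHn; case: n {IHn} => [|n] /=; first by rewrite expr0; ring.
by rewrite exprS; ring.
Qed.

Lemma derivation_opp_sumsq x y :
  d (- (x ^+ 2 + y ^+ 2)) = - (2%:R * (x * d x + y * d y)).
Proof. by rewrite derivationN dD !derivationX /=; ring. Qed.

Lemma derivation_rodrigues N J b w : d b = 0 ->
  d (rodrigues N J b w) = rodrigues N J.+1 b w * d w.
Proof.
move=> db; rewrite derivation_sum mulr_suml; apply: eq_bigr => i _.
rewrite derivationMn dM !derivationX derivationN db oppr0 mulr0 mul0r add0r.
by rewrite ffactnSr subnS; ring.
Qed.
End Derivation.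

(** * Real and imaginary parts of (x + i y)^m *)

Section Angular.
Variables (A : comNzRingType) (x y : A).

(* The real and imaginary parts of [(x + i y) ^+ m]. *)
Fixpoint cpow m : A * A :=
  if m is k.+1 then (x * (cpow k).1 - y * (cpow k).2, x * (cpow k).2 + y * (cpow k).1)
  else (1, 0).

Definition angular m (s : bool) : A := if s then (cpow m).1 else (cpow m).2.

(** With u = x + i y, these are the real and imaginary parts of 2x u^(m+1) = (u + conj u) u^(m+1),
    where u conj u = x^2 + y^2. *)
Lemma mul_x_angular m s :
  2%:R * x * angular m.+1 s = angular m.+2 s + (x ^+ 2 + y ^+ 2) * angular m s.
Proof. by rewrite /angular; case: s => /=; ring. Qed.

(** Now 2y = - i (u - conj u), and the factor - i exchanges real and imaginary parts up to sign. *)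
Lemma mul_y_angular m s : 2%:R * y * angular m.+1 s =
  (-1) ^+ (~~ s) * (angular m.+2 (~~ s) - (x ^+ 2 + y ^+ 2) * angular m (~~ s)).
Proof. by rewrite /angular; case: s => /=; ring. Qed.

End Angular.

Section AngularDerivation.
Variables (K : pzRingType) (A : comAlgType K) (x y : A) (d : A -> A).
Hypothesis hd : derivation d.
Let cpow := cpow x y.

Lemma derivation_cpow m :
  d (cpow m).1 = m%:R * ((cpow m.-1).1 * d x - (cpow m.-1).2 * d y) /\
  d (cpow m).2 = m%:R * ((cpow m.-1).2 * d x + (cpow m.-1).1 * d y).
Proof.
elim: m => [|m [IH1 IH2]] /=.
  by rewrite !mul0r (derivation0 hd) (derivation1 hd).
rewrite !(derivationD hd, derivationN hd, derivationM hd) -/cpow IH1 IH2.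
case: m {IH1 IH2} => [|m] /=.
  by rewrite !mul0r; split; ring.
by split; ring.
Qed.
End AngularDerivation.

Section GcoefShift.
Variable K : numFieldType.

Lemma gcoef_down m k : (m + k).+1%:R * gcoef K m.+1 k = gcoef K m k.
Proof.
rewrite /gcoef addSn factS.
have -> : (4 ^ k * k`! * ((m + k).+1 * (m + k)`!)
  = (m + k).+1 * (4 ^ k * k`! * (m + k)`!))%N by ring.
by rewrite [in X in _ * X]natrM invfM mulVKf// pnatr_eq0.
Qed.

Lemma gcoef_shift m k : (4 * k.+1)%:R * gcoef K m k.+1 = gcoef K m.+1 k.
Proof.
rewrite /gcoef addnS addSn expnS (factS k).
have -> : (4 * 4 ^ k * (k.+1 * k`!) * (m + k).+1`!
  = (4 * k.+1) * (4 ^ k * k`! * (m + k).+1`!))%N by ring.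
by rewrite [in X in _ * X]natrM invfM mulVKf// pnatr_eq0.
Qed.
End GcoefShift.

Section Ladder.
Variables (K : numFieldType) (A : comAlgType K) (N : nat).
Variables (d0 d1 d2 : A -> A) (b w x y : A).
Hypotheses (hd0 : derivation d0) (hd1 : derivation d1) (hd2 : derivation d2).
Hypotheses (d0b : d0 b = 0) (d0w : d0 w = 1) (d0x : d0 x = 0) (d0y : d0 y = 0).
Hypotheses (d1b : d1 b = 0) (d1w : d1 w = 0) (d1x : d1 x = 1) (d1y : d1 y = 0).
Hypotheses (d2b : d2 b = 0) (d2w : d2 w = 0) (d2x : d2 x = 0) (d2y : d2 y = 1).

(** By [hlegendreE], the j-th derivative of [hlegendre N b] at [w], but with [b] and [w] in the
    algebra [A]. *)
Definition hlegendre_at j : A := ((2 ^ N * N`!)%:R)^-1 *: rodrigues N (N + j) b w.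

(** The addition sum with r = - (x^2 + y^2). The index [e] counts extra derivatives of L: [e = 1] is
    the derivative along x_0. *)
Definition radial e m : A := \sum_(k < N.+1)
  gcoef K m k *: ((- (x ^+ 2 + y ^+ 2)) ^+ k * hlegendre_at (m + k.*2 + e)).

Lemma hlegendre_at_small j : (N < j)%N -> hlegendre_at j = 0.
Proof. by move=> Nj; rewrite /hlegendre_at rodrigues_small ?scaler0//; lia. Qed.

Lemma derivation_hlegendre_at d j : derivation d -> d b = 0 ->
  d (hlegendre_at j) = hlegendre_at j.+1 * d w.
Proof.
move=> hd db; rewrite /hlegendre_at (derivationZ hd) (derivation_rodrigues hd)// addnS.
by rewrite scalerAl.
Qed.

Lemma d0_radial m : d0 (radial 0 m) = radial 1 m.
Proof.
rewrite (derivation_sum hd0); apply: eq_bigr => k _.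
rewrite (derivationZ hd0) (derivationM hd0) (derivation_hlegendre_at _ hd0)// d0w mulr1.
rewrite (derivationX hd0) (derivation_opp_sumsq hd0) d0x d0y.
by rewrite !mulr0 addr0 mulr0 oppr0 mulr0 mul0r add0r addn0 addn1.
Qed.

(** Such a derivation only acts on the powers of x^2 + y^2. By [gcoef_shift], 4k times the
    coefficient of order m becomes, after a shift of k, the coefficient of order m + 1. *)
Lemma derivation_radial d m : derivation d -> d b = 0 -> d w = 0 ->
  2%:R * d (radial 0 m) = - ((x * d x + y * d y) * radial 1 m.+1).
Proof.
move=> hd db dw; rewrite (derivation_sum hd) /radial mulr_sumr mulr_sumr.
(* The term k = 0 on the left has derivative 0, and the term k = N on the right vanishes, its order
   of differentiation exceeding N. *)
rewrite big_ord_recl [in RHS]big_ord_recr /=.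
rewrite [X in _ = - (_ + X)](_ : _ = 0); last first.
  by rewrite hlegendre_at_small ?mulr0 ?scaler0 ?mulr0//; lia.
rewrite (derivationZ hd) expr0 mul1r (derivation_hlegendre_at _ hd)// dw.
rewrite !mulr0 scaler0 mulr0 add0r addr0.
rewrite -sumrN; apply: eq_bigr => k _ /=.
rewrite /bump add1n (derivationZ hd) (derivationM hd).
rewrite (derivation_hlegendre_at _ hd)// dw !mulr0 addr0.
rewrite (derivationX hd) (derivation_opp_sumsq hd) /= doubleS !addnS !addn0 addSn.
rewrite -gcoef_shift -scalerA scaler_nat.
rewrite -[in LHS](mulr_algl (gcoef K m k.+1)) -[in RHS](mulr_algl (gcoef K m k.+1)).
by ring.
Qed.

(** The analogue of the three-term recurrence of Bessel functions. In each term m + 1 is split as (m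
    + 1 + k) - k: [gcoef_down] lowers m in the first part, [gcoef_shift] lowers k in the second. *)
Lemma radial_rec m : (4 * m.+1)%:R * radial 0 m.+1 =
  4%:R * radial 1 m + (x ^+ 2 + y ^+ 2) * radial 1 m.+2.
Proof.
rewrite /radial !mulr_sumr big_ord_recl.
rewrite [X in _ = X + _]big_ord_recl [X in _ = _ + X]big_ord_recr /=.
rewrite [X in _ = _ + (_ + X)](_ : _ = 0) ?addr0; last first.
  by rewrite hlegendre_at_small ?mulr0 ?scaler0 ?mulr0//; lia.
rewrite -addrA; congr (_ + _).
  rewrite -[gcoef K m 0]gcoef_down !expr0 !addn0 addn1 -scalerA !scaler_nat.
  by move: (gcoef _ _ _ *: _) => p; ring.
rewrite -big_split; apply: eq_bigr => k _ /=.
rewrite /bump add1n -(gcoef_shift K m.+1 k) -(gcoef_down K m k.+1).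
rewrite doubleS !addSn !addnS !addn0 -!scalerA !scaler_nat exprS.
rewrite -[gcoef K m.+1 k.+1 *: (- _ * _ * _)]mulr_algl.
rewrite -[gcoef K m.+1 k.+1 *: ((- _) ^+ _ * _)]mulr_algl.
by ring.
Qed.

Lemma mulrn_scale k (p : A) : k%:R * p = (k%:R : K) *: p.
Proof. by rewrite mulr_natl scaler_nat. Qed.

(** The product of (N - m)! / (2N - 1)!!, the sign (-1)^m of P_N^m on [-1, 1], and the constant (N +
    m)! / (2^m (N - m)!) of the addition formula. *)
Definition amplitude m : K :=
  (-1) ^+ m * (N + m)`!%:R / (odd_fact N * 2 ^ m)%:R.

Definition spheroidal m s : A := amplitude m *: (angular x y m s * radial 0 m).

Lemma odd_fact_gt0 : (0 < odd_fact N)%N.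
Proof. by rewrite prodn_gt0. Qed.

Lemma amplitudeS m : amplitude m.+1 = - (N + m + 1)%:R / 2 * amplitude m.
Proof.
rewrite /amplitude addnS factS expnS exprS addn1 !natrM.
by field; rewrite !pnatr_eq0 -!lt0n odd_fact_gt0 expn_gt0.
Qed.

Lemma d0_spheroidal m s :
  d0 (spheroidal m s) = amplitude m *: (angular x y m s * radial 1 m).
Proof.
have [c1 c2] := derivation_cpow x y hd0 m.
rewrite /spheroidal (derivationZ hd0) (derivationM hd0) d0_radial /angular.
by case: s; rewrite ?c1 ?c2 d0x d0y !mulr0 ?subrr ?addr0 mulr0 mul0r add0r.
Qed.

Lemma scale4_invI (p q : A) : 4%:R * p = q -> p = (4^-1 : K) *: q.
Proof.
move=> <-; have n4 : 4 != 0 :> K by rewrite pnatr_eq0.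
transitivity ((4^-1 * 4 : K) *: p); first by rewrite mulVf ?scale1r.
by rewrite -scalerA mulrn_scale.
Qed.

(** In the product rule, [radial_rec] expands the term with the angular derivative and
    [mul_x_angular] the one with the radial derivative; the terms with x^2 + y^2 cancel. The ratios
    of amplitudes yield N + m + 1 and 1 / (N + m + 2). *)
Lemma ladder_x m s : d1 (spheroidal m.+1 s) =
  - 2^-1 *: ((N + m + 1)%:R *: d0 (spheroidal m s)
            - (N + m + 2)%:R^-1 *: d0 (spheroidal m.+2 s)).
Proof.
have [c1 c2] := derivation_cpow x y hd1 m.+1.
have ca : d1 (angular x y m.+1 s) = m.+1%:R * angular x y m s.
  by rewrite /angular; case: s; rewrite ?c1 ?c2 d1x d1y !mulr1 !mulr0 ?subr0 ?addr0.
have dr := derivation_radial m.+1 hd1 d1b d1w.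
rewrite d1x d1y mulr1 mulr0 addr0 in dr.
have := radial_rec m; have := mul_x_angular x y m s.
set h := angular x y m s in ca *; set h1 := angular x y m.+1 s in ca *.
set h2 := angular x y m.+2 s => hE rE.
have e : d1 (h1 * radial 0 m.+1) = (4^-1 : K) *:
    (4%:R * (h * radial 1 m) - h2 * radial 1 m.+2).
  apply: scale4_invI; rewrite (derivationM hd1) ca.
  transitivity (h * ((4 * m.+1)%:R * radial 0 m.+1)
      + 2%:R * h1 * (2%:R * d1 (radial 0 m.+1))).
    by ring.
  rewrite dr rE.
  transitivity (4%:R * (h * radial 1 m)
      - (2%:R * x * h1 - (x ^+ 2 + y ^+ 2) * h) * radial 1 m.+2).
    by ring.
  by rewrite hE; ring.
rewrite {1}/spheroidal (derivationZ hd1) e !d0_spheroidal -/h -/h2.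
rewrite mulrn_scale !scalerBr !scalerA; congr (_ *: _ - _ *: _).
  by rewrite amplitudeS; field.
rewrite (amplitudeS m.+1) (_ : N + m.+1 + 1 = N + m + 2)%N; last by lia.
have : (N + m + 2)%:R != 0 :> K by rewrite pnatr_eq0; lia.
by move: (_ + 2)%:R => q q0; field.
Qed.

Lemma ladder_y m s : d2 (spheroidal m.+1 s) =
  ((-1) ^+ (~~ s) / 2) *: ((N + m + 1)%:R *: d0 (spheroidal m (~~ s))
            + (N + m + 2)%:R^-1 *: d0 (spheroidal m.+2 (~~ s))).
Proof.
have [c1 c2] := derivation_cpow x y hd2 m.+1.
have ca : d2 (angular x y m.+1 s) = - (-1) ^+ (~~ s) * m.+1%:R * angular x y m (~~ s).
  rewrite /angular; case: s => /=; rewrite ?c1 ?c2 d2x d2y /=; ring.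
have dr := derivation_radial m.+1 hd2 d2b d2w.
rewrite d2x d2y mulr1 mulr0 add0r in dr.
have := radial_rec m; have := mul_y_angular x y m s.
set h := angular x y m (~~ s) in ca *; set h1 := angular x y m.+1 s in ca *.
set h2 := angular x y m.+2 (~~ s) => hE rE.
have e : d2 (h1 * radial 0 m.+1) = (4^-1 : K) *:
    (- (-1) ^+ (~~ s) * (4%:R * (h * radial 1 m) + h2 * radial 1 m.+2)).
  apply: scale4_invI; rewrite (derivationM hd2) ca.
  transitivity (- (-1) ^+ (~~ s) * h * ((4 * m.+1)%:R * radial 0 m.+1)
      + 2%:R * h1 * (2%:R * d2 (radial 0 m.+1))).
    by ring.
  rewrite dr rE.
  transitivity (- (-1) ^+ (~~ s) * h *
      (4%:R * radial 1 m + (x ^+ 2 + y ^+ 2) * radial 1 m.+2) - (2%:R * y * h1) * radial 1 m.+2).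
    by ring.
  by rewrite hE; ring.
rewrite {1}/spheroidal (derivationZ hd2) e !d0_spheroidal -/h -/h2.
have sgE p : - (-1) ^+ (~~ s) * p = (- (-1) ^+ (~~ s) : K) *: p :> A.
  by case: (s); rewrite /= ?expr0 ?expr1 ?opprK ?scale1r ?mul1r// mulN1r scaleN1r.
rewrite sgE mulrn_scale !scalerDr !scalerA; congr (_ *: _ + _ *: _).
  by rewrite amplitudeS; field.
rewrite (amplitudeS m.+1) (_ : N + m.+1 + 1 = N + m + 2)%N; last by lia.
have : (N + m + 2)%:R != 0 :> K by rewrite pnatr_eq0; lia.
by move: (_ + 2)%:R => q q0; field.
Qed.

(** For m = 0 the angular factor is the constant 1 or 0, so only the radial factor is
    differentiated. *)
Lemma ladder0 d s : derivation d -> d b = 0 -> d w = 0 ->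
  d (spheroidal 0 s) = if s then (N.+1%:R^-1 : K) *:
    (amplitude 1 *: ((x * d x + y * d y) * radial 1 1)) else 0.
Proof.
move=> hd db dw; rewrite /spheroidal (derivationZ hd) /angular /=.
case: s; last by rewrite mul0r (derivation0 hd) scaler0.
rewrite mul1r amplitudeS addn0 addn1 scalerA.
have -> : d (radial 0 0) = - ((2^-1 : K) *: ((x * d x + y * d y) * radial 1 1)).
  rewrite -scalerN -(derivation_radial 0 hd db dw) mulrn_scale scalerA.
  by rewrite mulVf ?scale1r// pnatr_eq0.
rewrite -scalerN !scalerA -scaleN1r scalerA; congr (_ *: _).
have : N.+1%:R != 0 :> K by rewrite pnatr_eq0.
by move: N.+1%:R => q q0; field.
Qed.

Lemma ladder0_x s :
  d1 (spheroidal 0 s) = if s then (N.+1%:R^-1 : K) *: d0 (spheroidal 1 s) else 0.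
Proof.
rewrite (ladder0 _ hd1 d1b d1w) d0_spheroidal /angular /= d1x d1y.
by case: s => //=; rewrite !mulr1 !mulr0 addr0 subr0.
Qed.

Lemma ladder0_y s :
  d2 (spheroidal 0 s) = if s then (N.+1%:R^-1 : K) *: d0 (spheroidal 1 (~~ s)) else 0.
Proof.
rewrite (ladder0 _ hd2 d2b d2w) d0_spheroidal /angular /= d2x d2y.
by case: s => //=; rewrite !mulr1 !mulr0 !add0r.
Qed.

End Ladder.

Local Open Scope classical_set_scope.
Local Open Scope ring_scope.
Local Open Scope complex_scope.

(** * Confocal coordinates *)

Section LegendreScaling.
Variable K : numFieldType.

Lemma double_fact n : ((2 * n)`! = 2 ^ n * n`! * odd_fact n)%N.
Proof.
elim: n => [|n IHn]; first by rewrite /odd_fact big_ord0.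
have -> : (2 * n.+1 = (2 * n).+2)%N by lia.
by rewrite !factS IHn /odd_fact big_ord_recr /= expnS -mul2n; ring.
Qed.

Lemma hlegendre0E n m (z : K) : (m <= n)%N ->
  (hlegendre n (0 : K))^`(m).[z] = (odd_fact n)%:R / (n - m)`!%:R * z ^+ (n - m).
Proof.
move=> mn; rewrite hlegendreE rodrigues0 -[_ *+ _ ^_ _]mulr_natl.
have -> : (2 * n - (n + m) = n - m)%N by lia.
have nz k : k`!%:R != 0 :> K by rewrite pnatr_eq0 -lt0n fact_gt0.
have nz2 : (2 ^ n)%:R != 0 :> K by rewrite pnatr_eq0 -lt0n expn_gt0.
have -> : ((2 * n) ^_ (n + m))%:R = (2 ^ n * n`! * odd_fact n)%:R / (n - m)`!%:R :> K.
  apply: (mulIf (nz (n - m)%N)); rewrite divfK// -natrM -double_fact.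
  by rewrite -{1}[(n - m)%N](_ : (2 * n - (n + m) = n - m)%N) ?ffact_fact//; lia.
by rewrite !natrM; field; rewrite nz nz2 nz.
Qed.

Lemma hlegendre_scale n m (c z : K) : (m <= n)%N ->
  (hlegendre n (c ^+ 2))^`(m).[c * z] = c ^+ (n - m) * (hlegendre n 1)^`(m).[z].
Proof.
move=> mn; have JN : (n + m <= 2 * n)%N by lia.
have := rodrigues_scale c 1 z JN; rewrite mulr1 => e.
have e2 : (2 * n - (n + m) = n - m)%N by lia.
rewrite e2 in e.
rewrite !hlegendreE e.
exact: mulrCA.
Qed.

End LegendreScaling.

Section Confocal.
Variable R : realType.
Implicit Types (mu : R[i]) (x : 'rV[R]_3) (n m : nat) (s : bool).

(** For real mu, Z is the semi-axis along x_0 of the spheroid through x with foci mu and - mu; its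
    equation x_0^2 / Z^2 + rho^2 / (Z^2 - mu^2) = 1 is cleared of denominators. *)
Lemma omega_quadratic mu x (Z := omega mu x / 2) :
  (Z ^+ 2 - mu ^+ 2) * (Z ^+ 2 - (x 0 0)%:C ^+ 2) = (rho x)%:C ^+ 2 * Z ^+ 2.
Proof.
rewrite /Z /omega.
set X := (x 0 0)%:C; set r := (rho x)%:C; set p := sqrtc _; set q := sqrtc _.
have p2 : p ^+ 2 = (X + mu) ^+ 2 + r ^+ 2 by exact: sqr_sqrtc.
have q2 : q ^+ 2 = (X - mu) ^+ 2 + r ^+ 2 by exact: sqr_sqrtc.
(* Both sides depend only on p^2, q^2 and p * q. *)
clearbody p q.
transitivity ((p ^+ 2 * (p ^+ 2 + 4 * (p * q))
    + q ^+ 2 * (q ^+ 2 + 4 * (p * q)) + 6 * (p ^+ 2 * q ^+ 2)) / 16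
  - (X ^+ 2 + mu ^+ 2) * (p ^+ 2 + q ^+ 2 + 2 * (p * q)) / 4 + X ^+ 2 * mu ^+ 2).
  by field.
transitivity (r ^+ 2 * (p ^+ 2 + q ^+ 2 + 2 * (p * q)) / 4); last by field.
by rewrite p2 q2; field.
Qed.

Lemma omega_ge_double mu x : 0 <= mu -> 2 * mu <= omega mu x.
Proof.
move=> mu0; have [a a0 ->] : exists2 a : R, 0 <= a & mu = a%:C.
  by case: mu mu0 => a b; rewrite lecE /= => /andP[/eqP -> a0]; exists a.
rewrite /omega.
have E (u v : R) : sqrtc (u%:C ^+ 2 + v%:C ^+ 2) = (Num.sqrt (u ^+ 2 + v ^+ 2))%:C.
  rewrite -!(rmorphXn (real_complex R)) -(rmorphD (real_complex R)).
  by rewrite sqrtc_sqrtr// lecR addr_ge0 ?sqr_ge0.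
rewrite -(rmorphD (real_complex R)) -(rmorphB (real_complex R)) !E.
rewrite -(rmorph_nat (real_complex R)) -(rmorphM (real_complex R)).
rewrite -(rmorphD (real_complex R)) lecR.
have h (u v : R) : u <= Num.sqrt (u ^+ 2 + v ^+ 2).
  apply: le_trans (ler_norm u) _.
  by rewrite -sqrtr_sqr ler_sqrt ?addr_ge0 ?sqr_ge0// lerDl sqr_ge0.
have := h (x 0 0 + a) (rho x); have := h (- (x 0 0 - a)) (rho x).
by rewrite sqrrN; lra.
Qed.

(** Z^2 - mu^2 is nonnegative, by [omega_ge_double] for real mu and because mu^2 < 0 for imaginary
    mu. The product of the two differences is rho^2 Z^2 > 0, so both are positive. *)
Lemma confocal_gt0 mu x : spheroidal_param mu -> regular_points mu x ->
  let Z := omega mu x / 2 in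
  [/\ 0 < Z, 0 < Z ^+ 2 - mu ^+ 2 & 0 < Z ^+ 2 - (x 0 0)%:C ^+ 2].
Proof.
move=> hmu [r0 w0] Z; have Z0 : 0 < Z by rewrite divr_gt0.
have r0c : 0 < (rho x)%:C by rewrite ltcR.
have rhs0 : 0 < (rho x)%:C ^+ 2 * Z ^+ 2 by rewrite mulr_gt0 ?exprn_gt0.
have ge0 : 0 <= Z ^+ 2 - mu ^+ 2.
  case: hmu => [/andP[mu0 _]|[a a0 ->]].
    rewrite subr_ge0 ler_sqr ?nnegrE ?(ltW Z0)// ler_pdivlMr// mulrC.
    exact: omega_ge_double.
  have -> : (a *i) ^+ 2 = - (a ^+ 2)%:C :> R[i].
    by rewrite expr2; simpc; rewrite expr2.
  by rewrite opprK addr_ge0 ?exprn_ge0 ?(ltW Z0)// lecR sqr_ge0.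
have := omega_quadratic mu x; rewrite -/Z => q.
have p0 : 0 < Z ^+ 2 - mu ^+ 2.
  rewrite lt0r ge0 andbT; apply/eqP => e; move: rhs0.
  by rewrite -q e mul0r ltxx.
by split=> //; rewrite -(pmulr_rgt0 _ p0) q.
Qed.

Lemma legendreE n : legendre R n = hlegendre n 1.
Proof. by rewrite /legendre /hlegendre polyC1. Qed.

Lemma assoc_legendre_in n m (t : R[i]) : -1 <= t <= 1 ->
  assoc_legendre n m t = (-1) ^+ m * sqrtc (1 - t ^+ 2) ^+ m * (hlegendre n 1)^`(m).[t].
Proof. by rewrite /assoc_legendre => ->; rewrite legendreE. Qed.

Lemma eq_pos_sqr (p q : R[i]) : 0 <= p -> 0 <= q -> p ^+ 2 = q ^+ 2 -> p = q.
Proof. by move=> p0 q0 /eqP; rewrite eqrXn2// => /eqP. Qed.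

Lemma Uhat_formula_regular mu n m x : spheroidal_param mu -> regular_points mu x ->
  Uhat_formula mu n m x = amplitude R[i] n m * (rho x)%:C ^+ m *
    addition_sum n m n.+1 (mu ^+ 2) (x 0 0)%:C (- (rho x)%:C ^+ 2).
Proof.
move=> hmu hx; rewrite /Uhat_formula.
have [nm|mn] := ltnP n m.
  rewrite /addition_sum big1 ?mulr0// => k _.
  by rewrite hlegendre_small ?horner0 ?mulr0//; lia.
have [Z0 Zmu ZX] := confocal_gt0 hmu hx; have quad := omega_quadratic mu x.
have [r0 w0] := hx.
set X := (x 0 0)%:C in ZX quad *; set r := (rho x)%:C in quad *.
have r0c : 0 < r by rewrite ltcR.
set w := omega mu x in w0 Z0 Zmu ZX quad *; set Z := w / 2 in Z0 Zmu ZX quad.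
have nZ : Z != 0 by rewrite gt_eqF.
pose t := X / Z.
have tE : 2 * X / w = t by rewrite /t /Z; field; rewrite gt_eqF.
have t2 : 1 - t ^+ 2 = (Z ^+ 2 - X ^+ 2) / Z ^+ 2 by rewrite /t; field.
have t2gt0 : 0 < 1 - t ^+ 2 by rewrite t2 divr_gt0 ?exprn_gt0.
have treal : t \is Num.real.
  by rewrite /t realM ?realV ?(gtr0_real Z0)// complex_real.
have tin : -1 <= t <= 1.
  rewrite -real_ler_norml// -(@expr_le1 _ 2)// real_normK//.
  by rewrite -subr_ge0 ltW.
pose S := sqrtc (1 - t ^+ 2).
have S0 : 0 <= S by rewrite sqrtc_ge0 ltW.
have S2 : S ^+ 2 = 1 - t ^+ 2 by exact: sqr_sqrtc.
pose L := (hlegendre n (mu ^+ 2))^`(m).[Z].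
(* The hypothesis of the addition formula on [r] is [omega_quadratic] divided by Z^2. *)
have : addition_sum n m n.+1 (mu ^+ 2) X (- r ^+ 2) *
    (m`!%:R * ((n + m)`!%:R / (2 ^ m * m`! * (n - m)`!)%:R)) =
  L * (hlegendre n 1)^`(m).[t].
  rewrite -hlegendre_at1// (@addition_formula _ n m n.+1 (mu ^+ 2) Z t)//.
    by rewrite /t mulrC divfK.
  apply: (mulfI (_ : Z ^+ 2 != 0)); first by rewrite expf_neq0.
  rewrite t2; transitivity (- (r ^+ 2 * Z ^+ 2)); first by ring.
  by rewrite -quad; field.
set As := addition_sum _ _ _ _ _ _ => add.
have nz k : k`!%:R != 0 :> R[i] by rewrite pnatr_eq0 -lt0n fact_gt0.
have nz2 : (2 ^ m)%:R != 0 :> R[i] by rewrite pnatr_eq0 -lt0n expn_gt0.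
have nzo : (odd_fact n)%:R != 0 :> R[i] by rewrite pnatr_eq0 -lt0n odd_fact_gt0.
have -> : amplitude R[i] n m * r ^+ m * As = (n - m)`!%:R / (odd_fact n)%:R *
    (-1) ^+ m * r ^+ m * (L * (hlegendre n 1)^`(m).[t]).
  rewrite -add /amplitude !natrM; field.
  by rewrite !nz nz2 nzo.
(* If mu = 0, then Z = |x|, [t] is the cosine of the polar angle, and rho = [S * Z]. *)
have [mu0|mu0] := eqVneq mu 0.
  have LE : L = (odd_fact n)%:R / (n - m)`!%:R * Z ^+ (n - m).
    by rewrite /L mu0 expr0n; exact: hlegendre0E.
  have ZE : Z ^+ 2 = X ^+ 2 + r ^+ 2.
    apply: (mulIf (_ : Z ^+ 2 != 0)); first by rewrite expf_neq0.
    by rewrite mulrDl -quad mu0; ring.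
  have nE : (euclid_norm x)%:C = Z.
    apply: eq_pos_sqr; rewrite ?(ltW Z0) ?lecR ?sqrtr_ge0//.
    rewrite ZE -!(rmorphXn (real_complex R)) -(rmorphD (real_complex R)); congr (_ %:C).
    by rewrite /euclid_norm /rho !sqr_sqrtr ?addr_ge0 ?sqr_ge0// addrA.
  rewrite (rmorphM (real_complex R)) (fmorphV (real_complex R)) /= nE -/X -/t.
  rewrite (assoc_legendre_in n m tin) -/S LE.
  have -> : r = S * Z.
    apply: (eq_pos_sqr (ltW r0c) (mulr_ge0 S0 (ltW Z0))).
    by rewrite exprMn S2 t2 divfK ?expf_neq0// ZE; ring.
  rewrite -{1}(subnK mn) exprD [(S * Z) ^+ _]exprMn.
  by field; rewrite nzo nz.
pose z := Z / mu.
have zE : w / (2 * mu) = z by rewrite /z /Z; field.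
have z2E : z ^+ 2 * mu ^+ 2 = Z ^+ 2 by rewrite /z; field.
(* Thus the second Legendre factor takes the branch outside the segment. A z in [-1, 1] would
   contradict Z^2 > mu^2 if mu^2 >= 0, and Z^2 > 0 if mu^2 <= 0. *)
have znin : (-1 <= z <= 1) = false.
  apply/negP => zin; have zr : z \is Num.real by case/andP: zin => _ /ler1_real.
  have z1 : 0 <= 1 - z ^+ 2.
    move: zin; rewrite -real_ler_norml// -(@expr_le1 _ 2)// real_normK//.
    by rewrite subr_ge0.
  have z0 : 0 <= z ^+ 2 by rewrite -real_normK// exprn_ge0.
  have [m2|m2] : 0 <= mu ^+ 2 \/ mu ^+ 2 <= 0.
  - case: hmu => [/andP[h _]|[a a0 ->]]; first by left; rewrite exprn_ge0.
    right; have -> : (a *i) ^+ 2 = - (a ^+ 2)%:C :> R[i].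
      by rewrite expr2; simpc; rewrite expr2.
    by rewrite oppr_le0 lecR sqr_ge0.
  - move: Zmu; rewrite -z2E.
    have -> : z ^+ 2 * mu ^+ 2 - mu ^+ 2 = - ((1 - z ^+ 2) * mu ^+ 2) by ring.
    by rewrite oppr_gt0 => /lt_geF; rewrite mulr_ge0.
  - have : 0 < Z ^+ 2 by rewrite exprn_gt0.
    by rewrite -z2E => /lt_geF; rewrite mulr_ge0_le0.
rewrite tE zE (assoc_legendre_in n m tin) -/S /assoc_legendre znin legendreE.
have T2gt0 : 0 < 1 - z ^- 2.
  have -> : 1 - z ^- 2 = (Z ^+ 2 - mu ^+ 2) / Z ^+ 2 by rewrite /z; field; rewrite mu0 nZ.
  by rewrite divr_gt0 ?exprn_gt0.
set T := sqrtc (1 - z ^- 2).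
have T0 : 0 <= T by rewrite sqrtc_ge0 ltW.
(* This is rho = mu sin u sinh v: [S] is sin u, and [z * T] is (z^2 - 1)^(1/2) with z = cosh v. *)
have -> : r = mu * S * (z * T).
  have -> : mu * S * (z * T) = Z * S * T by rewrite /z; field.
  apply: (eq_pos_sqr (ltW r0c) (mulr_ge0 (mulr_ge0 (ltW Z0) S0) T0)).
  rewrite [(Z * S * T) ^+ 2]exprMn [(Z * S) ^+ 2]exprMn S2 t2 sqr_sqrtc.
  apply: (mulIf (_ : Z ^+ 2 != 0)); first by rewrite expf_neq0.
  by rewrite -quad /z; field; rewrite mu0 nZ.
have LE : L = mu ^+ (n - m) * (hlegendre n 1)^`(m).[z].
  by rewrite -hlegendre_scale// /z [mu * _]mulrC divfK.
have -> : mu ^+ n = mu ^+ (n - m) * mu ^+ m by rewrite -exprD subnK.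
rewrite LE [(mu * S * _) ^+ m]exprMn [(mu * S) ^+ m]exprMn.
by move: (z * T) => zT; field.
Qed.

End Confocal.

(** * Density of the regular points, continuous extension and the polar angle *)

Section Extension.
Variable R : realType.
Implicit Types (mu : R[i]) (x y : 'rV[R]_3).

(** Off the cut, principal roots of conjugate numbers are conjugate, so the sum is twice a positive
    real part. *)
Lemma sqrtc_add_conj (a b : R) : b != 0 ->
  0 < sqrtc (a +i* b) + sqrtc (a +i* - b).
Proof.
move=> b0; rewrite /= !sqrrN oppr_eq0 (negPf b0) sgrN mulNr.
set r := Num.sqrt (a ^+ 2 + b ^+ 2); have ra : 0 < r + a.
  rewrite -ltrBlDr sub0r; apply: le_lt_trans (ler_norm _) _.
  have s0 : 0 < b ^+ 2 by rewrite exprn_even_gt0.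
  by rewrite normrN -sqrtr_sqr ltr_sqrt ?ltrDl// ltr_wpDl ?sqr_ge0.
rewrite ltcE /= subrr eqxx /=.
by rewrite addr_gt0// sqrtr_gt0 divr_gt0.
Qed.

Lemma rho_gt0 x : x 0 1 != 0 -> 0 < rho x.
Proof.
by move=> x1; rewrite sqrtr_gt0 ltr_wpDr ?sqr_ge0// exprn_even_gt0.
Qed.

Lemma regular_off_planes mu x : spheroidal_param mu -> x 0 0 != 0 -> x 0 1 != 0 ->
  regular_points mu x.
Proof.
move=> hmu x0 x1; have r0 := rho_gt0 x1; split=> //.
case: hmu => [/andP[mu0 _]|[a a0 ->]].
  have := omega_ge_double x mu0; have := omega_quadratic mu x.
  move=> q ge; have : 0 <= omega mu x by apply: le_trans ge; rewrite mulr_ge0.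
  rewrite le_eqVlt => /orP[/eqP e|//].
  have mu00 : mu = 0.
    apply/eqP; rewrite eq_le mu0 andbT -(pmulr_rle0 _ (_ : 0 < 2))// (le_trans ge)//.
    by rewrite -e.
  move: e; rewrite mu00 /omega addr0 subr0 => /esym/eqP.
  rewrite -mulr2n mulrn_eq0 sqrtc_eq0 => /orP[//|].
  rewrite -!(rmorphXn (real_complex R)) -(rmorphD (real_complex R)).
  rewrite (fmorph_eq0 (real_complex R)).
  by rewrite paddr_eq0 ?sqr_ge0// !sqrf_eq0 (negPf x0).
rewrite /omega.
have -> : ((x 0 0)%:C + a *i) ^+ 2 + (rho x)%:C ^+ 2 =
  (x 0 0 ^+ 2 - a ^+ 2 + rho x ^+ 2) +i* (2 * x 0 0 * a) :> R[i].
  by rewrite !expr2; simpc; congr (_ +i* _); ring.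
have -> : ((x 0 0)%:C - a *i) ^+ 2 + (rho x)%:C ^+ 2 =
  (x 0 0 ^+ 2 - a ^+ 2 + rho x ^+ 2) +i* (- (2 * x 0 0 * a)) :> R[i].
  by rewrite !expr2; simpc; congr (_ +i* _); ring.
by apply: sqrtc_add_conj; rewrite !mulf_neq0// gt_eqF.
Qed.

Lemma regular_points_dense mu x : spheroidal_param mu -> closure (regular_points mu) x.
Proof.
move=> hmu A /nbhs_ballP[e /= e0 eA].
pose move_off (u : R) := if u == 0 then e / 2 else u.
have off0 u : move_off u != 0.
  rewrite /move_off; case: (eqVneq u 0) => [_|//].
  by rewrite gt_eqF// divr_gt0.
have offe u : `|u - move_off u| < e.
  rewrite /move_off; case: (eqVneq u 0) => [->|_]; last by rewrite subrr normr0.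
  rewrite sub0r normrN gtr0_norm ?divr_gt0//; lra.
pose y : 'rV[R]_3 := \row_i move_off (x 0 i).
exists y; split; first by apply: regular_off_planes => //; rewrite mxE.
by apply: eA; split=> // i j; rewrite mxE ord1; exact: offe.
Qed.

Lemma normc_real (a : R) : `|a%:C| = `|a|%:C :> R[i].
Proof. by rewrite normc_def /= expr0n /= addr0 sqrtr_sqr. Qed.

(** Density of the regular points makes the filter in [extend] proper, so the limit is unique and
    [get] can only return [g x]. *)
Lemma extendE mu (f : 'rV[R]_3 -> R[i]) (g : 'rV[R]_3 -> R) : spheroidal_param mu ->
  continuous g -> (forall y, regular_points mu y -> f y = (g y)%:C) ->
  extend mu f = g.
Proof.
move=> hmu gc fg; apply/funext => x.
have FF : ProperFilter (within (regular_points mu) (nbhs x)).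
  by apply: within_nbhs_proper; exact: regular_points_dense.
have lim : (f y : R[i]^o) @[y --> within (regular_points mu) (nbhs x)]
    --> ((g x)%:C : R[i]^o).
  apply/cvgrPdist_lt => e e0; rewrite near_withinE.
  have [d d0 ->] : exists2 d : R, 0 < d & e = d%:C.
    by case: e e0 => a b; rewrite ltcE /= => /andP[/eqP -> a0]; exists a.
  have /cvgrPdist_lt /(_ d d0) := gc x.
  apply: filterS => y gd Dy.
  by rewrite fg// -(rmorphB (real_complex R)) normc_real ltcR.
have ex : exists r : R, (f y : R[i]^o) @[y --> within (regular_points mu) (nbhs x)]
      --> (r%:C : R[i]^o) by exists (g x).
have := xgetPex point ex; rewrite -/(extend mu f x) /= => lim2.
have /(_ (fmap_proper_filter _ FF)) := cvg_unique (@norm_hausdorff _ R[i]^o) lim2 lim.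
by move=> /(congr1 (@complex.Re R)).
Qed.

Lemma phi_spec x : x 0 1 = rho x * cos (phi x) /\ x 0 2 = rho x * sin (phi x).
Proof.
pose P (t : R) := x 0 1 = rho x * cos t /\ x 0 2 = rho x * sin t.
suff ex : exists t, P t by exact: (xgetPex point ex).
have r2 : rho x ^+ 2 = x 0 1 ^+ 2 + x 0 2 ^+ 2 by rewrite sqr_sqrtr// addr_ge0 ?sqr_ge0.
have [r0|r0] := eqVneq (rho x) 0.
  move/eqP: r2; rewrite r0 expr0n /= eq_sym paddr_eq0 ?sqr_ge0// !sqrf_eq0.
  by move=> /andP[/eqP e1 /eqP e2]; exists 0; rewrite /P r0 !mul0r e1 e2.
have rp : 0 < rho x by rewrite lt0r r0 sqrtr_ge0.
pose c := x 0 1 / rho x.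
have c1 : -1 <= c <= 1.
  rewrite -ler_norml -(@expr_le1 _ 2)// real_normK ?num_real//.
  by rewrite expr_div_n ler_pdivrMr ?exprn_gt0// mul1r r2 lerDl sqr_ge0.
have cE : rho x * cos (acos c) = x 0 1 by rewrite acosK ?in_itv// mulrC divfK.
have sE : rho x * sin (acos c) = `|x 0 2|.
  rewrite sin_acos// -[X in X * _](gtr0_norm rp) -sqrtr_sqr -sqrtrM ?sqr_ge0//.
  rewrite -sqrtr_sqr; congr Num.sqrt.
  by rewrite mulrBr mulr1 -exprMn [rho x * c]mulrC divfK// r2; ring.
have [x2|x2] := leP 0 (x 0 2).
  by exists (acos c); split; rewrite ?cE ?sE// ger0_norm.
exists (- acos c); split; first by rewrite cosN cE.
by rewrite sinN mulrN sE ltr0_norm// opprK.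
Qed.

(** De Moivre's formula. It also holds on the axis, whatever [phi] is there, because [phi_spec]
    does. *)
Lemma angular_polar x m s : angular (x 0 1) (x 0 2) m s = rho x ^+ m * Phi s m (phi x).
Proof.
have [e1 e2] := phi_spec x; set r := rho x in e1 e2 *; set t := phi x in e1 e2 *.
have h k : (cpow (x 0 1) (x 0 2) k).1 = r ^+ k * cos (k%:R * t) /\
           (cpow (x 0 1) (x 0 2) k).2 = r ^+ k * sin (k%:R * t).
  elim: k => [|k [IH1 IH2]]; first by rewrite /= mul0r cos0 sin0 expr0 mulr1 mulr0.
  rewrite /= IH1 IH2 e1 e2 exprS -natr1 mulrDl mul1r cosD sinD.
  by split; ring.
by have [h1 h2] := h m; rewrite /angular /Phi; case: s; rewrite ?h1 ?h2.
Qed.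

End Extension.

(** * Polynomiality and the first-order operator *)

Section PolynomialFunctions.
Variable R : realType.
Implicit Types (mu : R[i]) (x y : 'rV[R]_3) (p q : mpoly 4 R).

Definition mvar (i : 'I_4) : mpoly 4 R := mpolyX R (mnm1 i).

Lemma derivation_mderiv (i : 'I_4) : @derivation R (mpoly 4 R) (@mderiv 4 R i).
Proof. by split; [exact: mderivD | exact: mderivM | exact: mderivZ]. Qed.

Lemma mderiv_mvar i j : mderiv i (mvar j) = (i == j)%:R.
Proof.
rewrite mderivX mnm1E eq_sym; case: eqP => [->|_]; last by rewrite scale0r.
rewrite scale1r (_ : mnm_sub _ _ = mnm0) ?mpolyX0//.
by apply/mnmP => k; rewrite mnmBE mnm0E subnn.
Qed.

Lemma mpoly_ind_ring (P : mpoly 4 R -> Prop) :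
  (forall c, P (c%:A)) -> (forall i, P (mvar i)) ->
  (forall p q, P p -> P q -> P (p + q)) -> (forall p q, P p -> P q -> P (p * q)) ->
  forall p, P p.
Proof.
move=> Pc PX PD PM p; elim/mpolyind: p => [|c m p _ _ Pp].
  by rewrite -(scale0r 1).
apply: (PD _ _) => //; rewrite -mulr_algl; apply: (PM _ _) => //.
rewrite mpolyXE_id; have P1 : P 1 by rewrite -(scale1r 1).
elim/big_ind: _ => [//|u v|i _]; first exact: (PM _ _).
by elim: (m i) => [|k IHk]; [rewrite expr0 | rewrite exprS; exact: (PM _ _ (PX i) IHk)].
Qed.

Lemma poly_point_lift mu x (i : 'I_3) : poly_point mu x (lift ord0 i) = x 0 i.
Proof.
by rewrite /poly_point; case: i => [[|[|[|]]]] //= hi; congr (x 0 _); apply: val_inj.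
Qed.

Lemma is_derive_coord x (i j : 'I_3) :
  is_derive x ('e_i) (fun y : 'rV[R]_3 => y 0 j) (i == j)%:R.
Proof.
have lim : h^-1 *: ((h *: 'e_i + x : 'rV[R]_3) 0 j - x 0 j) @[h --> 0^']
    --> ((i == j)%:R : R).
  apply: cvg_near_cst; near=> h.
  rewrite !mxE eqxx /= addrK eq_sym [_ *: _]mulKf//.
  by near: h; exact: nbhs_dnbhs_neq.
by split; [apply/cvg_ex; eexists; exact: lim | exact: cvg_lim].
Unshelve. all: by end_near. Qed.

(** Variable [ord0] stands for mu^2, constant in space, and [lift ord0 i] for x_i. *)
Lemma is_derive_meval mu x (i : 'I_3) p :
  is_derive x ('e_i) (fun y => meval (poly_point mu y) p)
    (meval (poly_point mu x) (mderiv (lift ord0 i) p)).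
Proof.
elim/mpoly_ind_ring: p => [c|j|p q ihp ihq|p q ihp ihq].
- rewrite mderivZ -(mpolyC1 4 R) mderivC scaler0 meval0.
  rewrite (_ : (fun y => _) = cst c); first exact: is_derive_cst.
  by apply/funext => y; rewrite mevalZ mpolyC1 meval1 mulr1.
- rewrite mderiv_mvar (_ : (fun y => _) = fun y => poly_point mu y j); last first.
    by apply/funext => y; rewrite mevalXU.
  case: (unliftP ord0 j) => [k ->|->].
    rewrite (_ : (fun y => _) = fun y : 'rV[R]_3 => y 0 k); last first.
      by apply/funext => y; rewrite poly_point_lift.
    rewrite (inj_eq lift_inj) rmorph_nat; exact: is_derive_coord.
  by rewrite eq_sym (negPf (neq_lift _ _)) meval0; exact: is_derive_cst.
- rewrite mderivD mevalD (_ : (fun y => _) =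
    (fun y => meval (poly_point mu y) p) \+ (fun y => meval (poly_point mu y) q)).
    exact: is_deriveD.
  by apply/funext => y; rewrite mevalD.
- rewrite mderivM mevalD !mevalM (_ : (fun y => _) =
    (fun y => meval (poly_point mu y) p) \* (fun y => meval (poly_point mu y) q)).
    apply: (is_derive_eq (is_deriveM ihp ihq)).
    by rewrite /= addrC [_ *: _]mulrC.
  by apply/funext => y; rewrite mevalM.
Qed.

Lemma continuous_meval mu p : continuous (fun y => meval (poly_point mu y) p).
Proof.
elim/mpoly_ind_ring: p => [c|j|p q ihp ihq|p q ihp ihq] x.
- rewrite (_ : (fun y => _) = cst c); first exact: cst_continuous.
  by apply/funext => y; rewrite mevalZ meval1 mulr1.
- rewrite (_ : (fun y => _) = fun y => poly_point mu y j); last first.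
    by apply/funext => y; rewrite mevalXU.
  case: (unliftP ord0 j) => [k ->|->]; last exact: cst_continuous.
  rewrite (_ : (fun y => _) = fun y : 'rV[R]_3 => y 0 k); first exact: coord_continuous.
  by apply/funext => y; rewrite poly_point_lift.
- under eq_fun do rewrite mevalD.
  by apply: continuousD; [exact: ihp | exact: ihq].
- under eq_fun do rewrite mevalM.
  by apply: continuousM; [exact: ihp | exact: ihq].
Qed.

End PolynomialFunctions.

Lemma rmorph_angular (A B : comNzRingType) (f : {rmorphism A -> B}) x y m s :
  f (angular x y m s) = angular (f x) (f y) m s.
Proof.
have [h1 h2] : f (cpow x y m).1 = (cpow (f x) (f y) m).1 /\
               f (cpow x y m).2 = (cpow (f x) (f y) m).2.
  elim: m => [|m [IH1 IH2]]; first by rewrite /= rmorph1 rmorph0.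
  by rewrite /= rmorphB rmorphD !rmorphM IH1 IH2.
by rewrite /angular; case: s.
Qed.

Lemma rmorph_addition_sum (K L : numFieldType) (f : {rmorphism K -> L}) N m n b w r :
  f (addition_sum N m n b w r) = addition_sum N m n (f b) (f w) (f r).
Proof.
rewrite rmorph_sum; apply: eq_bigr => k _ /=.
rewrite !rmorphM rmorphXn !hlegendreE rmorphM rmorph_rodrigues.
by rewrite /gcoef !fmorphV !rmorph_nat.
Qed.

Lemma rmorph_amplitude (K L : numFieldType) (f : {rmorphism K -> L}) N m :
  f (amplitude K N m) = amplitude L N m.
Proof. by rewrite /amplitude !(rmorphM f) fmorphV rmorphXn rmorphN1 !rmorph_nat. Qed.

(** * The functions U and V as polynomials in mu^2 and the coordinates *)

Section SpheroidalPolynomials.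
Variable R : realType.
Implicit Types (mu : R[i]) (x y : 'rV[R]_3) (n N m : nat) (s : bool).

Definition spoly_radial N m : mpoly 4 R := @radial R (mpoly 4 R) N
  (mvar R ord0) (mvar R (lift ord0 0)) (mvar R (lift ord0 1)) (mvar R (lift ord0 2)) 0 m.

Definition spoly N m s : mpoly 4 R := @spheroidal R (mpoly 4 R) N
  (mvar R ord0) (mvar R (lift ord0 0)) (mvar R (lift ord0 1)) (mvar R (lift ord0 2)) m s.

Lemma meval_radial N m (v : 'I_4 -> R) : meval v (spoly_radial N m) =
  addition_sum N m N.+1 (v ord0) (v (lift ord0 0))
    (- (v (lift ord0 1) ^+ 2 + v (lift ord0 2) ^+ 2)).
Proof.
rewrite rmorph_sum; apply: eq_bigr => k _ /=.
rewrite mevalZ mevalM rmorphXn /= mevalN mevalD !rmorphXn /= !mevalXU addn0 mulrA.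
by rewrite mevalZ rmorph_rodrigues /= !mevalXU hlegendreE.
Qed.

Lemma meval_spoly N m s (v : 'I_4 -> R) : meval v (spoly N m s) =
  amplitude R N m * (angular (v (lift ord0 1)) (v (lift ord0 2)) m s *
    meval v (spoly_radial N m)).
Proof. by rewrite mevalZ mevalM rmorph_angular /= !mevalXU. Qed.

Lemma param_sqr_real mu : spheroidal_param mu -> mu ^+ 2 = (complex.Re (mu ^+ 2))%:C.
Proof.
case=> [/andP[mu0 _]|[a _ ->]].
  case: mu mu0 => a b; rewrite lecE /= => /andP[/eqP -> _].
  by rewrite expr2; simpc.
by rewrite expr2; simpc.
Qed.

Lemma Uhat_formulaE mu N m y : spheroidal_param mu -> regular_points mu y ->
  Uhat_formula mu N m y =
  (amplitude R N m * rho y ^+ m * meval (poly_point mu y) (spoly_radial N m))%:C.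
Proof.
move=> hmu hy; rewrite Uhat_formula_regular//.
rewrite -(rmorph_amplitude (real_complex R)) -(rmorphXn (real_complex R)).
rewrite -(rmorphM (real_complex R)) [RHS](rmorphM (real_complex R)); congr (_ * _).
rewrite meval_radial (rmorph_addition_sum (real_complex R)) !poly_point_lift.
have -> : mu ^+ 2 = (poly_point mu y ord0)%:C by exact: param_sqr_real.
have -> : - (rho y)%:C ^+ 2 = (- (y 0 1 ^+ 2 + y 0 2 ^+ 2))%:C :> R[i].
  rewrite (rmorphN (real_complex R)) -(rmorphXn (real_complex R)) /=.
  by rewrite sqr_sqrtr// addr_ge0 ?sqr_ge0.
by [].
Qed.

Lemma U_poly mu N m s : spheroidal_param mu ->
  U mu N m s = fun y => meval (poly_point mu y) (spoly N m s).
Proof.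
move=> hmu; apply: extendE => // [|y hy]; first exact: continuous_meval.
rewrite Uhat_formulaE// -(rmorphM (real_complex R)); congr (_ %:C).
by rewrite meval_spoly !poly_point_lift angular_polar; ring.
Qed.

Lemma continuous_rho : continuous (@rho R).
Proof.
move=> x; apply: continuous_comp; last exact: sqrt_continuous.
have c (i : 'I_3) : {for x, continuous (fun y : 'rV[R]_3 => y 0 i ^+ 2)}.
  apply: (@continuous_comp _ _ _ (fun y : 'rV[R]_3 => y 0 i) (fun u : R => u ^+ 2)).
    exact: coord_continuous.
  exact: exprn_continuous.
by apply: continuousD; exact: c.
Qed.

(** The factor rho^m is left without its angular part, so this need not be a polynomial. It serves
    V_(n,-1), which is defined from [Uhat]. *)
Lemma Uhat_poly mu N m : spheroidal_param mu ->
  Uhat mu N m = fun y => amplitude R N m * rho y ^+ m *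
    meval (poly_point mu y) (spoly_radial N m).
Proof.
move=> hmu; apply: extendE => // [x|y hy]; last exact: Uhat_formulaE.
apply: (@continuousM R _ (fun y => amplitude R N m * rho y ^+ m)
  (fun y => meval (poly_point mu y) (spoly_radial N m)) x); last exact: continuous_meval.
apply: (@continuousM R _ (fun=> amplitude R N m) (fun y => rho y ^+ m) x).
  exact: cst_continuous.
apply: (@continuous_comp _ _ _ (@rho R) (fun u : R => u ^+ m)).
  exact: continuous_rho.
exact: exprn_continuous.
Qed.

Lemma derive_meval mu x (i : 'I_3) p :
  'D_('e_i) (fun y => meval (poly_point mu y) p) x =
  meval (poly_point mu x) (mderiv (lift ord0 i) p).
Proof. by have [] := is_derive_meval mu x i p. Qed.

Lemma derive_U mu N m s x (i : 'I_3) : spheroidal_param mu ->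
  'D_('e_i) (U mu N m s) x = meval (poly_point mu x) (mderiv (lift ord0 i) (spoly N m s)).
Proof. by move=> hmu; rewrite U_poly// derive_meval. Qed.

Let i0 : 'I_4 := lift ord0 (0 : 'I_3).
Let i1 : 'I_4 := lift ord0 (1 : 'I_3).
Let i2 : 'I_4 := lift ord0 (2 : 'I_3).

(** Along x_0 this lets rho, which is not differentiable on the axis, be treated as a constant. *)
Lemma derive_eq_on_line (f g : 'rV[R]_3 -> R) x v :
  (forall h : R, f (h *: v + x) = g (h *: v + x)) -> 'D_v f x = 'D_v g x.
Proof.
move=> fg; have fgx : f x = g x by have := fg 0; rewrite scale0r add0r.
rewrite /derive fgx.
suff -> : (fun h => h^-1 *: ((f \o shift x) (h *: v) - g x)) =
          (fun h => h^-1 *: ((g \o shift x) (h *: v) - g x)) by [].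
by apply/funext => h /=; rewrite fg.
Qed.

(** The derivative along x_0 passes over rho, and rho Phi_1(phi) is the polynomial x_1 or x_2. The
    sign [(-1) ^+ (~~ s)] comes from Phi_(-1), which is plus or minus Phi_1. *)
Lemma V_neg mu n s x : spheroidal_param mu ->
  V mu n (Negz 0) s x = - ((-1) ^+ (~~ s) / (n.+1 * n.+2)%:R) *
    meval (poly_point mu x) (mderiv i0 (spoly n.+1 1 s)).
Proof.
move=> hmu; set a := amplitude R n.+1 1; set g := spoly_radial n.+1 1.
have rho0 (h : R) : rho (h *: 'e_0 + x) = rho x by rewrite /rho !mxE /= !mulr0 !add0r.
have -> : V mu n (Negz 0) s x = - ((n.+1 * n.+2)%:R)^-1 *
    (a * rho x * meval (poly_point mu x) (mderiv i0 g)) * Phi s (Negz 0) (phi x).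
  rewrite /V /Vhat; congr (_ * _ * _).
  rewrite -mevalZ -mderivZ -derive_meval Uhat_poly//.
  by apply: derive_eq_on_line => h; rewrite expr1 rho0 mevalZ.
have -> : Phi s (Negz 0) (phi x) = (-1) ^+ (~~ s) * Phi s (Posz 1) (phi x).
  by rewrite /Phi NegzE mulrNz mulNr cosN sinN; case: s; rewrite ?mul1r ?mulN1r.
have dr : mderiv i0 g = @radial R (mpoly 4 R) n.+1 (mvar R ord0) (mvar R i0)
   (mvar R i1) (mvar R i2) 1 1.
  by apply: (d0_radial _ (derivation_mderiv R i0)); rewrite mderiv_mvar.
rewrite dr /spoly (d0_spheroidal _ (derivation_mderiv R i0)) ?mderiv_mvar//.
rewrite mevalZ mevalM rmorph_angular /= !mevalXU !poly_point_lift angular_polar.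
by rewrite expr1 -/a -/i0 -/i1 -/i2; ring.
Qed.

Lemma derive_qreal (f : 'rV[R]_3 -> R) x v : derivable f x v ->
  'D_v (fun y => qreal (f y)) x = qreal ('D_v f x).
Proof.
move=> df.
have E (i : 'I_1) (j : 'I_4) : (fun y => qreal (f y) i j) = if j == 0 then f else cst 0.
  apply/funext => y; rewrite mxE.
  by case: j => [[|[|[|[|]]]]].
rewrite derive_mx; last first.
  apply/derivable_mxP => i j; rewrite E; case: (j == 0); first exact: df.
  exact: derivable_cst.
apply/matrixP => i j; rewrite !mxE E.
by case: j => [[|[|[|[|]]]]] //= _; exact: derive_cst.
Qed.

Lemma qmul_e1 (a : R) : qmul e1 (qreal a) = a *: e1.
Proof.
apply/rowP => j; rewrite !mxE /=.
by case: j => [[|[|[|[|]]]]] //= _; ring.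
Qed.

Lemma qmul_e2 (a : R) : qmul e2 (qreal a) = a *: e2.
Proof.
apply/rowP => j; rewrite !mxE /=.
by case: j => [[|[|[|[|]]]]] //= _; ring.
Qed.

Lemma X_components mu n m s x : spheroidal_param mu ->
  X mu n m s x = qreal (meval (poly_point mu x) (mderiv i0 (spoly n.+1 m s)))
    - meval (poly_point mu x) (mderiv i1 (spoly n.+1 m s)) *: e1
    - meval (poly_point mu x) (mderiv i2 (spoly n.+1 m s)) *: e2.
Proof.
move=> hmu; rewrite /X /del U_poly//.
have d i : derivable (fun y => meval (poly_point mu y) (spoly n.+1 m s)) x ('e_i).
  by have [] := is_derive_meval mu x i (spoly n.+1 m s).
rewrite !derive_qreal// !derive_meval.
by rewrite qmul_e1 qmul_e2.
Qed.

Lemma meval_combD (v : 'I_4 -> R) (a b c : R) (p q : mpoly 4 R) :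
  meval v (a *: (b *: p + c *: q)) = a * (b * meval v p + c * meval v q).
Proof. by rewrite mevalZ mevalD !mevalZ. Qed.

Lemma meval_combB (v : 'I_4 -> R) (a b c : R) (p q : mpoly 4 R) :
  meval v (a *: (b *: p - c *: q)) = a * (b * meval v p - c * meval v q).
Proof. by rewrite mevalZ mevalB !mevalZ. Qed.

Let hd i : derivation (@mderiv 4 R i) := derivation_mderiv R i.

Lemma V_nonneg mu n (k : nat) s x : spheroidal_param mu ->
  V mu n k s x = meval (poly_point mu x) (mderiv i0 (spoly n.+1 k s)).
Proof. exact: derive_U. Qed.

Lemma V_ladder_x mu n m s x : spheroidal_param mu ->
  - meval (poly_point mu x) (mderiv i1 (spoly n.+1 m s)) =
  2^-1 * ((n + m + 1)%:R * V mu n (m%:Z - 1) s x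
          - (n + m + 2)%:R^-1 * V mu n (m%:Z + 1) s x).
Proof.
move=> hmu; have -> : m%:Z + 1 = m.+1%:Z by rewrite -addn1 PoszD.
rewrite V_nonneg//; case: m => [|m].
  (* For m = 0 both neighbours are multiples of the same derivative: the two contributions add up if
     [s] is true and cancel otherwise, in accordance with [ladder0_x]. *)
  rewrite (_ : 0%:Z - 1 = Negz 0)// V_neg//.
  rewrite /spoly (ladder0_x _ (hd i0) (hd i1)) ?mderiv_mvar// -/(spoly _ _ _).
  have nz : n.+1%:R != 0 :> R by rewrite pnatr_eq0.
  have nz2 : n.+2%:R != 0 :> R by rewrite pnatr_eq0.
  rewrite addn0 addn1 addn2 natrM.
  move: n.+1%:R n.+2%:R nz nz2 => u v u0 v0.
  by case: s => /=; rewrite ?mevalZ ?meval0; field; rewrite u0 v0.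
have -> : m.+1%:Z - 1 = m%:Z by rewrite -addn1 PoszD addrK.
rewrite V_nonneg// /spoly (ladder_x _ (hd i0) (hd i1)) ?mderiv_mvar//.
by rewrite -!/(spoly _ _ _) meval_combB mulNr opprK -!addSnnS.
Qed.

Lemma V_ladder_y mu n m s x : spheroidal_param mu ->
  meval (poly_point mu x) (mderiv i2 (spoly n.+1 m s)) =
  (if s then 1 else -1) *
  (2^-1 * ((n + m + 1)%:R * V mu n (m%:Z - 1) (~~ s) x
           + (n + m + 2)%:R^-1 * V mu n (m%:Z + 1) (~~ s) x)).
Proof.
move=> hmu; have -> : m%:Z + 1 = m.+1%:Z by rewrite -addn1 PoszD.
rewrite V_nonneg//; case: m => [|m].
  rewrite (_ : 0%:Z - 1 = Negz 0)// V_neg//.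
  rewrite /spoly (ladder0_y _ (hd i0) (hd i2)) ?mderiv_mvar// -/(spoly _ _ _).
  have nz : n.+1%:R != 0 :> R by rewrite pnatr_eq0.
  have nz2 : n.+2%:R != 0 :> R by rewrite pnatr_eq0.
  rewrite addn0 addn1 addn2 natrM.
  move: n.+1%:R n.+2%:R nz nz2 => u v u0 v0.
  by case: s => /=; rewrite ?mevalZ ?meval0; field; rewrite u0 v0.
have -> : m.+1%:Z - 1 = m%:Z by rewrite -addn1 PoszD addrK.
rewrite V_nonneg// /spoly (ladder_y _ (hd i0) (hd i2)) ?mderiv_mvar//.
by rewrite -!/(spoly _ _ _) meval_combD -!addSnnS; case: s; rewrite mulrA.
Qed.

End SpheroidalPolynomials.

Theorem theorem3p1 (R : realType) (n m : nat) (s : bool) (hm : (m <= n.+1)%N) :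
  (forall (mu : complex R) (x : 'rV[R]_3), spheroidal_param mu ->
     X mu n m s x =
       qreal (V mu n m%:Z s x)
       + (2^-1 * ((n + m + 1)%:R * V mu n (m%:Z - 1) s x
                  - (n + m + 2)%:R^-1 * V mu n (m%:Z + 1) s x)) *: e1
       - ((if s then 1 else -1) *
          (2^-1 * ((n + m + 1)%:R * V mu n (m%:Z - 1) (~~ s) x
                   + (n + m + 2)%:R^-1 * V mu n (m%:Z + 1) (~~ s) x))) *: e2)
  /\
  (exists p : 'I_4 -> mpoly.mpoly 4 R,
     forall (mu : complex R) (x : 'rV[R]_3), spheroidal_param mu ->
       forall j : 'I_4, X mu n m s x 0 j = mpoly.meval (poly_point mu x) (p j)).
Proof.
split=> [mu x hmu|].
  by rewrite X_components// V_nonneg// -V_ladder_x// -V_ladder_y// scaleNr.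
pose d i := mderiv (lift ord0 i : 'I_4) (spoly R n.+1 m s).
(* The coefficients of 1, e_1, e_2, e_3; the signs are those of [del]. *)
exists (fun j => [:: d 0; - d 1; - d 2; 0]`_j) => mu x hmu j.
rewrite X_components// !mxE /=.
by case: j => [[|[|[|[|]]]]] //= _; rewrite ?mevalN ?meval0 /d; ring.
Qed.
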